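(* Let $f:\mathbb{R}^n\to\overline{\mathbb{R}}$ be $\mathcal{C}^2$-smooth around $\bar x$ and $g:\mathbb{R}^n\to\overline{\mathbb{R}}$ proper lower semicontinuous. Then for any $\bar v\in\partial g(\bar x)$ we have $\nabla f(\bar x)+\bar v\in\partial(f+g)(\bar x)$ and $\mathrm{quad}(f+g)(\bar x|\nabla f(\bar x)+\bar v)=\tfrac12q_{\nabla^2f(\bar x)}+\mathrm{quad}\,g(\bar x|\bar v)$, i.e. the set of functions $\tfrac12q_{\nabla^2f(\bar x)}+p$ with $p\in\mathrm{quad}\,g(\bar x|\bar v)$. In particular, $\mathrm{quad}\,f(\bar x|\nabla f(\bar x))=\{\tfrac12d^2f(\bar x|\nabla f(\bar x))\}=\{\tfrac12q_{\nabla^2f(\bar x)}\}$.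
   Context: $q_A(x)=\langle x,Ax\rangle$. $\partial$ is the limiting subdifferential. $d^2h(x|v)(w)=\liminf_{t\downarrow0,w'\to w}\frac{h(x+tw')-h(x)-t\langle v,w'\rangle}{\frac12t^2}$; twice epi-differentiability at $x$ for $v$ means these quotients epi-converge as $t\downarrow0$. A generalized quadratic form is $\frac12q_A+\delta_L$ with $A$ symmetric, $L$ a linear subspace. $h$ is generalized twice differentiable at $x$ for $v\in\partial h(x)$ if twice epi-differentiable there with $d^2h(x|v)$ a generalized quadratic form. $\Omega_h=\{(x,v)\in\operatorname{gph}\partial h:h$ generalized twice differentiable at $x$ for $v\}$. The quadratic bundle $\mathrm{quad}\,h(\bar x|\bar v)$ is the set of generalized quadratic forms $q$ for which there exist $(x_k,v_k)\in\Omega_h$, $(x_k,v_k)\to(\bar x,\bar v)$, $h(x_k)\to h(\bar x)$, with $\frac12d^2h(x_k|v_k)$ epi-converging to $q$. *)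

(* Defs.v *)
From HB Require Import structures.
From mathcomp Require Import all_boot all_order all_algebra.
From mathcomp Require Import all_classical all_reals all_analysis.

Set Implicit Arguments.
Unset Strict Implicit.
Unset Printing Implicit Defensive.

Import Order.TTheory GRing.Theory Num.Theory.
Import numFieldNormedType.Exports.

Local Open Scope classical_set_scope.
Local Open Scope ring_scope.

Section Defs.
Variables (R : realType) (n : nat).
Notation V := 'rV[R]_n.

Definition inner (x y : V) : R := \sum_(i < n) x 0 i * y 0 i.

Definition qform (A : 'M[R]_n) (x : V) : R :=
  \sum_(i < n) \sum_(j < n) x 0 i * A i j * x 0 j.

Definition proper_fun (h : V -> \bar R) : Prop :=
  (forall x, h x != -oo%E) /\ (exists x, h x != +oo%E).

Definition lsc (h : V -> \bar R) : Prop :=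
  forall x (a : R), (a%:E < h x)%E -> \forall y \near x, (a%:E < h y)%E.

Definition reg_subgrad (h : V -> \bar R) (x v : V) : Prop :=
  h x \is a fin_num /\
  forall eps : R, 0 < eps ->
    \forall y \near x, (h x + (inner v (y - x) - eps * `|y - x|)%:E <= h y)%E.

Definition lim_subgrad (h : V -> \bar R) (x v : V) : Prop :=
  h x \is a fin_num /\
  exists (xs vs : nat -> V),
    [/\ xs @ \oo --> x, (fun k => h (xs k)) @ \oo --> h x,
        vs @ \oo --> v & forall k, reg_subgrad h (xs k) (vs k)].

Definition dquot (h : V -> \bar R) (x v : V) (t : R) (w : V) : \bar R :=
  ((h (x + t *: w)%R - h x - (t * inner v w)%:E) * (2 / t ^+ 2)%:E)%E.

Definition d2 (h : V -> \bar R) (x v : V) (w : V) : \bar R :=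
  ereal_sup [set ereal_inf [set dquot h x v t w' | t in [set t : R | 0 < t < d]
                                                 & w' in [set w' | `|w' - w| < d]]
            | d in [set d : R | 0 < d]].

Definition epi_conv (phis : nat -> V -> \bar R) (phi : V -> \bar R) : Prop :=
  forall w,
    (forall ws : nat -> V, ws @ \oo --> w ->
       (phi w <= limn_einf (fun k => phis k (ws k)))%E) /\
    (exists ws : nat -> V, ws @ \oo --> w /\
       (limn_esup (fun k => phis k (ws k)) <= phi w)%E).

Definition twice_epi_diff (h : V -> \bar R) (x v : V) : Prop :=
  forall ts : nat -> R, (forall k, 0 < ts k) -> ts @ \oo --> 0 ->
    epi_conv (fun k => dquot h x v (ts k)) (d2 h x v).

(* generalized quadratic form 1/2 q_A + delta_L, A symmetric, L subspace
   (every linear subspace of R^n is the row space of some L : 'M_n) *)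
Definition gen_quad_form (q : V -> \bar R) : Prop :=
  exists (A L : 'M[R]_n), A^T = A /\
    q = (fun w => if (w <= L)%MS then (qform A w / 2)%:E else +oo%E).

Definition gen_twice_diff (h : V -> \bar R) (x v : V) : Prop :=
  twice_epi_diff h x v /\ gen_quad_form (d2 h x v).

Definition Omega (h : V -> \bar R) (x v : V) : Prop :=
  lim_subgrad h x v /\ gen_twice_diff h x v.

Definition quad_bundle (h : V -> \bar R) (xb vb : V) : set (V -> \bar R) :=
  [set q | gen_quad_form q /\
     exists (xs vs : nat -> V),
       [/\ forall k, Omega h (xs k) (vs k),
           xs @ \oo --> xb, vs @ \oo --> vb,
           (fun k => h (xs k)) @ \oo --> h xb &
           epi_conv (fun k w => ((2^-1)%:E * d2 h (xs k) (vs k) w)%E) q]].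

Definition is_grad (phi : V -> R) (x g : V) : Prop :=
  forall eps : R, 0 < eps ->
    \forall y \near x, `|phi y - phi x - inner g (y - x)| <= eps * `|y - x|.

(* Frechet Jacobian (as matrix H, G(y) ~ G(x) + H (y - x)) *)
Definition is_jac (G : V -> V) (x : V) (H : 'M[R]_n) : Prop :=
  forall eps : R, 0 < eps ->
    \forall y \near x, `|G y - G x - (y - x) *m H^T| <= eps * `|y - x|.

Definition C2_around (f : V -> \bar R) (xb : V) (G : V -> V)
    (H : V -> 'M[R]_n) : Prop :=
  exists U : set V, open U /\ U xb /\ [/\
    (forall y, U y -> f y \is a fin_num),
    (forall y, U y -> is_grad (fun z => fine (f z)) y (G y)),
    (forall y, U y -> is_jac G y (H y)) &
    (forall y, U y -> H @ y --> H y)].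

End Defs.

(* Main.v *)
Require Import Defs.
From HB Require Import structures.
From mathcomp Require Import all_boot all_order all_algebra.
From mathcomp Require Import all_classical all_reals all_analysis.
From mathcomp Require Import ring lra.
Import Order.TTheory GRing.Theory Num.Theory.
Import numFieldNormedType.Exports.
Local Open Scope classical_set_scope.
Local Open Scope ring_scope.

Set Implicit Arguments.
Unset Strict Implicit.
Unset Printing Implicit Defensive.

(** On an open set where [f] is C^2, [f + g] is [g] plus a finite C^2 function
    [phi], and [g] is in turn [f + g] plus [- phi]; so it suffices to transport
    every notion one way under such a perturbation.  The mean value theorem on
    segments gives [phi (x + h) = phi x + <G x, h> + q_(H x) (h) / 2 + o(|h|^2)],
    hence the difference quotients defining [d2] change by a term that converges
    continuously to [q_(H x)].  Continuously convergent finite terms can be added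
    to epi-limits, which handles twice epi-differentiability at a fixed point as
    well as, by continuity of [H], the limits defining the quadratic bundle.
    The statement about [f] alone is the case where the unperturbed function is
    zero. *)

(** * Inner products and quadratic forms: algebra, bounds and continuity *)

Section InnerProduct.
Context {R : realType} {n : nat}.
Implicit Types (x y z w : 'rV[R]_n) (A B : 'M[R]_n).

Lemma innerE x y : inner x y = (x *m y^T) 0 0.
Proof. by rewrite mxE; apply: eq_bigr => i _; rewrite mxE. Qed.

Lemma innerDl x y z : inner (x + y) z = inner x z + inner y z.
Proof. by rewrite !innerE mulmxDl mxE. Qed.

Lemma innerNl x y : inner (- x) y = - inner x y.
Proof. by rewrite !innerE mulNmx mxE. Qed.

Lemma innerBl x y z : inner (x - y) z = inner x z - inner y z.
Proof. by rewrite innerDl innerNl. Qed.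

Lemma innerZr a x y : inner x (a *: y) = a * inner x y.
Proof. by rewrite !innerE linearZ /= -scalemxAr mxE. Qed.

Lemma innerZl a x y : inner (a *: x) y = a * inner x y.
Proof. by rewrite !innerE -scalemxAl mxE. Qed.

Lemma inner0l x : inner 0 x = 0.
Proof. by rewrite -(scale0r (0 : 'rV[R]_n)) innerZl mul0r. Qed.

Lemma inner0r x : inner x 0 = 0.
Proof. by rewrite -(scale0r (0 : 'rV[R]_n)) innerZr mul0r. Qed.

Lemma inner_self_eq0 x : inner x x <= 0 -> x = 0.
Proof.
move=> x0; have sq i : 0 <= x 0 i * x 0 i by rewrite -expr2 sqr_ge0.
have /psumr_eq0P xx0 : inner x x = 0.
  by apply/eqP; rewrite eq_le x0; apply: sumr_ge0 => i _.
apply/rowP => i; rewrite mxE; apply/eqP.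
by rewrite -[_ == 0]orbb -mulf_eq0 xx0.
Qed.

Lemma ler_coord_norm x i : `|x 0 i| <= `|x|.
Proof.
by have /= := le_bigmax 0 (fun ij : 'I_1 * 'I_n => `|x ij.1 ij.2|) (0, i);
  rewrite -mx_normrE.
Qed.

(** Stands in for Cauchy-Schwarz: the norm on row vectors is the maximum norm, so each of the [n]
    products is bounded by [|x| * |y|]. *)
Lemma ler_norm_inner x y : `|inner x y| <= n%:R * (`|x| * `|y|).
Proof.
apply: (le_trans (ler_norm_sum _ _ _)).
rewrite mulr_natl -[X in _ *+ X]card_ord -sumr_const.
by apply: ler_sum => i _; rewrite normrM ler_pM// ler_coord_norm.
Qed.

(** The transpose matches the convention of [is_jac], where the Jacobian acts on row vectors by
    [*m H^T]; linearity and homogeneity of the form are then inherited from [inner]. *)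
Lemma qformE A w : qform A w = inner (w *m A^T) w.
Proof.
apply: eq_bigr => i _; rewrite mxE big_distrl/=.
by apply: eq_bigr => j _; rewrite mxE; ring.
Qed.

Lemma qformD A B w : qform (A + B) w = qform A w + qform B w.
Proof. by rewrite !qformE linearD /= mulmxDr innerDl. Qed.

Lemma qformN A w : qform (- A) w = - qform A w.
Proof. by rewrite !qformE linearN /= mulmxN innerNl. Qed.

Lemma qformZr A a w : qform A (a *: w) = a ^+ 2 * qform A w.
Proof. by rewrite !qformE -scalemxAl innerZl innerZr mulrA. Qed.

Lemma qformZl A a w : qform (a *: A) w = a * qform A w.
Proof. by rewrite !qformE linearZ /= -scalemxAr innerZl. Qed.

Lemma qform_tr A w : qform A^T w = qform A w.
Proof.
rewrite /qform exchange_big/=; apply: eq_bigr => i _; apply: eq_bigr => j _.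
by rewrite mxE; ring.
Qed.

Lemma cvg_coord {T : Type} {F : set_system T} {FF : Filter F} {m p : nat}
    (us : T -> 'M[R]_(m, p)) (u : 'M[R]_(m, p)) i j :
  us @ F --> u -> us k i j @[k --> F] --> u i j.
Proof.
move=> uu.
apply: (@cvg_comp _ _ _ us (fun M : 'M[R]_(m, p) => M i j) F (nbhs u)
  (nbhs (u i j)) uu).
exact: (@coord_continuous R m p i j u).
Qed.

Lemma cvg_inner {T : Type} {F : set_system T} {FF : Filter F}
    (us ws : T -> 'rV[R]_n) (u w : 'rV[R]_n) :
  us @ F --> u -> ws @ F --> w -> inner (us k) (ws k) @[k --> F] --> inner u w.
Proof.
move=> uu ww; apply: cvg_big => [|i _]; first exact: add_continuous.
by apply: cvgM; exact: cvg_coord.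
Qed.

(** Continuity is joint in matrix and vector because, for the quadratic bundle, the Hessian and its
    argument vary together along a sequence. *)
Lemma cvg_qform {T : Type} {F : set_system T} {FF : Filter F}
    (As : T -> 'M[R]_n) (ws : T -> 'rV[R]_n) (A : 'M[R]_n) (w : 'rV[R]_n) :
  As @ F --> A -> ws @ F --> w -> qform (As k) (ws k) @[k --> F] --> qform A w.
Proof.
move=> AA ww; apply: cvg_big => [|i _]; first exact: add_continuous.
apply: cvg_big => [|j _]; first exact: add_continuous.
by apply: cvgM; [apply: cvgM|]; exact: cvg_coord.
Qed.

End InnerProduct.

(** * Upper and lower limits under a nearly constant finite shift *)

Section ExtendedLimits.
Context {R : realType}.
Implicit Types (u v : (\bar R)^nat) (c : R).

(** The upper limit is an infimum, over eventual sets of indices, of suprema; any such set can be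
    cut down to the indices where the assumed bound holds. The shift is finite, so infinite values
    of [u] and [v] do no harm. *)
Lemma limn_esup_leD u v c :
  (forall e : R, 0 < e -> \forall k \near \oo, (u k <= v k + (c + e)%:E)%E) ->
  (limn_esup u <= limn_esup v + c%:E)%E.
Proof.
move=> uv; apply/lee_addgt0Pr => e e0; rewrite -addeA -EFinD -leeBlDr//.
apply: le_ereal_inf_tmp => _ [S S_oo <-]; rewrite leeBlDr//.
apply: (@le_trans _ _
  (ereal_sup (u @` (S `&` [set k | (u k <= v k + (c + e)%:E)%E])))).
  apply: ereal_inf_lbound; exists (S `&` [set k | (u k <= v k + (c + e)%:E)%E]) => //.
  by apply: filterI => //; exact: uv.
apply: ge_ereal_sup => _ [k [Sk /= uvk] <-]; apply: (le_trans uvk).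
by apply: leeD2r; apply: ereal_sup_ubound; exists k.
Qed.

Lemma limn_einf_leD u v c :
  (forall e : R, 0 < e -> \forall k \near \oo, (u k + (c - e)%:E <= v k)%E) ->
  (limn_einf u + c%:E <= limn_einf v)%E.
Proof.
move=> uv; rewrite /limn_einf leeNr fin_num_oppeD// oppeK -EFinN.
apply: limn_esup_leD => e e0; apply: filterS (uv e e0) => k.
by rewrite leeNl fin_num_oppeD// oppeK -EFinN opprD opprK.
Qed.

End ExtendedLimits.

(** * Second-order expansion of a C^2 function and its difference quotients *)

Section SecondOrderExpansion.
Context {R : realType} {n : nat}.
Notation V := 'rV[R]_n.
Implicit Types (x v w h : V) (phi : V -> R) (U : set V).

Definition C2_on U phi (G : V -> V) (H : V -> 'M[R]_n) : Prop :=
  [/\ open U,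
      (forall y, U y -> is_grad phi y (G y)),
      (forall y, U y -> is_jac G y (H y)) &
      (forall y, U y -> H @ y --> H y)].

Lemma near_norm_ball (x : V) (P : V -> Prop) :
  (\forall y \near x, P y) ->
  exists2 d : R, 0 < d & forall y, `|y - x| < d -> P y.
Proof.
move=> /nbhs_normP[d /= d0 xP]; exists d => // y yx.
by apply: xP; rewrite /ball_/= distrC.
Qed.

Lemma is_derive_line phi x h (s : R) g : is_grad phi (x + s *: h) g ->
  is_derive s 1 (fun s : R => phi (x + s *: h)) (inner g h).
Proof.
move=> gradg.
suff lim : r^-1 *: (phi (x + (r *: 1 + s) *: h) - phi (x + s *: h)) @[r --> (0:R)^']
    --> inner g h.
  by split; [exact: cvgP lim|exact: cvg_lim lim].
apply/cvgrPdist_le => e e0.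
(* Adding 1 keeps the divisor positive when [h = 0]. *)
have h1 : 0 < `|h| + 1 by rewrite ltr_pwDr.
have e'0 : 0 < e / (`|h| + 1) by rewrite divr_gt0.
have [d d0 dP] := near_norm_ball (gradg _ e'0).
near=> r.
have r0 : r != 0 by near: r; exact: nbhs_dnbhs_neq.
have nr0 : 0 < `|r| by rewrite normr_gt0.
have rd : `|r| < d / (`|h| + 1).
  near: r; apply: dnbhs0_lt; exact: divr_gt0.
have eqy : x + (r *: 1 + s) *: h - (x + s *: h) = r *: h.
  by rewrite scalerDl [r *: 1]mulr1 opprD addrACA subrr add0r addrK.
have {dP} := dP (x + (r *: 1 + s) *: h).
rewrite eqy normrZ innerZr => dP.
have hd : `|r| * `|h| < d.
  rewrite (le_lt_trans _ (_ : `|r| * (`|h| + 1) < d))// -?ltr_pdivlMr//.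
  by rewrite ler_wpM2l// lerDl.
have {dP hd} := dP hd.
set D := phi _ - phi _ => dP.
have -> : inner g h - r^-1 *: D = r^-1 * (r * inner g h - D).
  by rewrite mulrBr mulKf.
rewrite normrM normfV ler_pdivrMl// distrC (le_trans dP)//.
rewrite mulrCA ler_wpM2l// -mulrA ler_piMr ?(ltW e0)//.
by rewrite ler_pdivrMl// mulr1 lerDl.
Unshelve. all: by end_near. Qed.

(** Let [psi] be [phi] along the segment minus its linear and quadratic model. By the mean value
    theorem the error is [psi 1 - psi 0 = dpsi c], and [dpsi c] is the inner product with [h] of the
    first-order remainder of [G] at [x + c *: h], which is [o(|h|)]. *)
Lemma second_order_expansion U phi G H x : C2_on U phi G H -> U x ->
  forall e : R, 0 < e -> exists2 d : R, 0 < d & forall h, `|h| < d ->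
    U (x + h) /\
    `|phi (x + h) - phi x - inner (G x) h - qform (H x) h / 2| <= e * `|h| ^+ 2.
Proof.
move=> [oU gradG jacH _] Ux e e0.
(* The divisor absorbs the factor [n] of [ler_norm_inner]; the successor keeps it nonzero in
   dimension 0. *)
have e'0 : 0 < e / n.+1%:R by rewrite divr_gt0.
have [d d0 dP] : exists2 d : R, 0 < d & forall y, `|y - x| < d ->
    U y /\ `|G y - G x - (y - x) *m (H x)^T| <= e / n.+1%:R * `|y - x|.
  apply: near_norm_ball; apply: filterI; last exact: jacH.
  exact: open_nbhs_nbhs.
exists d => // h hd.
have segd (s : R) : 0 <= s <= 1 -> `|x + s *: h - x| < d.
  move=> /andP[s0 s1]; rewrite addrC addKr normrZ ger0_norm//.
  by rewrite (le_lt_trans _ hd)// ler_piMl.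
split.
  by have [] := dP (x + h) _; rewrite -[h]scale1r// segd// ler01 lexx.
pose psi (s : R) := phi (x + s *: h) - (s * inner (G x) h + s ^+ 2 * (qform (H x) h / 2)).
pose dpsi (s : R) := inner (G (x + s *: h)) h - (inner (G x) h + s * qform (H x) h).
have psiD (s : R) : 0 <= s <= 1 -> is_derive s 1 psi (dpsi s).
  move=> s01; have [Us _] := dP _ (segd _ s01).
  have D1 := is_derive_line (gradG _ Us).
  apply: is_derive_eq; rewrite /dpsi; congr (_ - _).
  by rewrite /GRing.scale/=; field.
have [||c c01 psi10] := @MVT_segment R psi dpsi 0 1 ler01.
- by move=> s; rewrite in_itv/= => /andP[s0 s1]; apply: psiD; rewrite !ltW.
- apply: derivable_within_continuous => s; rewrite in_itv/= => s01.
  by have [] := psiD s s01.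
move: c01; rewrite in_itv/= => /[dup] c01 /andP[c0 c1].
have -> : phi (x + h) - phi x - inner (G x) h - qform (H x) h / 2 = psi 1 - psi 0.
  by rewrite /psi scale1r scale0r addr0; ring.
rewrite psi10 subr0 mulr1.
have -> : dpsi c = inner (G (x + c *: h) - G x - (x + c *: h - x) *m (H x)^T) h.
  by rewrite !innerBl [x + _ - x]addrC addKr -scalemxAl innerZl -qformE /dpsi; ring.
apply: (le_trans (ler_norm_inner _ _)).
have [_ /=] := dP _ (segd _ c01).
rewrite [x + _ - x]addrC addKr normrZ (ger0_norm c0) => jac.
apply: (@le_trans _ _ (n%:R * (e / n.+1%:R * `|h| * `|h|))).
  rewrite ler_wpM2l// ler_wpM2r// (le_trans jac)// ler_wpM2l ?(ltW e'0)//.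
  by rewrite ler_piMl.
rewrite -[_ * `|h| * `|h|]mulrA -expr2 mulrA ler_wpM2r ?sqr_ge0//.
by rewrite mulrCA ler_piMr ?(ltW e0)// ler_pdivrMr// mul1r ler_nat.
Qed.

Definition rquot phi x v (t : R) w : R :=
  (phi (x + t *: w) - phi x - t * inner v w) * (2 / t ^+ 2).

(** This is continuous convergence: one radius [d] controls the step [t] and the direction [w']
    together, as both [d2] and epi-convergence require. *)
Lemma rquot_near U phi G H x w : C2_on U phi G H -> U x ->
  forall e : R, 0 < e -> exists2 d : R, 0 < d & forall t w', 0 < t < d ->
    `|w' - w| < d ->
    U (x + t *: w') /\ `|rquot phi x (G x) t w' - qform (H x) w| <= e.
Proof.
move=> C2 Ux e e0.
have w1 : 0 < `|w| + 1 by rewrite ltr_pwDr.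
(* The expansion error, once multiplied by [2 / t ^+ 2], is at most
   [2 * e' * (|w| + 1) ^+ 2 = e / 2]; the other half of [e] pays for replacing [w'] by [w] in the
   form. *)
pose e' := e / (4 * (`|w| + 1) ^+ 2).
have e'0 : 0 < e' by rewrite divr_gt0// mulr_gt0// exprn_gt0.
have [d1 d10 d1P] := second_order_expansion C2 Ux e'0.
have [d2 d20 d2P] : exists2 d : R, 0 < d & forall w', `|w' - w| < d ->
    `|qform (H x) w' - qform (H x) w| <= e / 2.
  apply: near_norm_ball.
  have : qform (H x) w' @[w' --> w] --> qform (H x) w.
    apply: (@cvg_qform R n V (nbhs w) _ (fun=> H x) id); [exact: cvg_cst|exact: cvg_id].
  move=> /cvgrPdist_le/(_ _ (divr_gt0 e0 (ltr0n _ 2))).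
  by apply: filterS => w'; rewrite distrC.
(* The bound 1 gives [|w'| <= |w| + 1], so the first entry keeps [t *: w'] within [d1]; [d2] is the
   radius from continuity of the form. *)
exists (Num.min (d1 / (`|w| + 1)) (Num.min d2 1)).
  by rewrite !lt_min d20 ltr01 divr_gt0.
move=> t w' /andP[t0]; rewrite !lt_min => /and3P[td1 _ _] /and3P[_ wd2 wd1].
have w'1 : `|w'| <= `|w| + 1.
  by rewrite -[w'](subrK w) (le_trans (ler_normD _ _))// addrC lerD2l ltW.
have tw : `|t *: w'| < d1.
  rewrite normrZ gtr0_norm// (le_lt_trans _ (_ : t * (`|w| + 1) < d1))//.
    by rewrite ler_wpM2l// (ltW t0).
  by rewrite -ltr_pdivlMr.
have [Ut exp] := d1P _ tw; split => //.
have -> : rquot phi x (G x) t w' - qform (H x) w =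
    (phi (x + t *: w') - phi x - inner (G x) (t *: w') - qform (H x) (t *: w') / 2)
      * (2 / t ^+ 2) + (qform (H x) w' - qform (H x) w).
  rewrite /rquot innerZr qformZr; field; exact: lt0r_neq0.
rewrite (le_trans (ler_normD _ _))// [e](splitr e) lerD ?d2P//.
rewrite normrM [`|2 / _|]gtr0_norm ?divr_gt0 ?exprn_gt0//.
apply: (@le_trans _ _ (e' * `|t *: w'| ^+ 2 * (2 / t ^+ 2))).
  by rewrite ler_wpM2r// divr_ge0// sqr_ge0.
rewrite normrZ gtr0_norm//.
have -> : e' * (t * `|w'|) ^+ 2 * (2 / t ^+ 2) = e' * 2 * `|w'| ^+ 2.
  by field; exact: lt0r_neq0.
apply: (@le_trans _ _ (e' * 2 * (`|w| + 1) ^+ 2)).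
  apply: ler_wpM2l; first by rewrite mulr_ge0// ltW.
  by rewrite ler_sqr ?nnegrE// ltW.
rewrite le_eqVlt; apply/orP; left; apply/eqP.
rewrite /e'; field; exact: lt0r_neq0.
Qed.

End SecondOrderExpansion.

(** * Transport of subgradients, second subderivatives and quadratic bundles under a C^2
    perturbation *)

Section Perturbation.
Context {R : realType} {n : nat}.
Notation V := 'rV[R]_n.
Implicit Types (x v w : V) (phi : V -> R) (U : set V) (h : V -> \bar R).
Implicit Types (G : V -> V) (H : V -> 'M[R]_n).

Definition perturbed U phi h1 h2 : Prop :=
  forall y, U y -> h2 y = (h1 y + (phi y)%:E)%E.

Lemma perturbedN U phi h1 h2 :
  perturbed U phi h1 h2 -> perturbed U (fun y => - phi y) h2 h1.
Proof. by move=> h12 y Uy; rewrite h12// EFinN addeK. Qed.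

Lemma C2_onN U phi G H : C2_on U phi G H ->
  C2_on U (fun y => - phi y) (fun y => - G y) (fun y => - H y).
Proof.
move=> [oU gradG jacH cH]; split => // y Uy.
- move=> e e0; apply: filterS (gradG y Uy e e0) => z.
  by rewrite innerNl -!opprD normrN.
- move=> e e0; apply: filterS (jacH y Uy e e0) => z.
  by rewrite [(- H y)^T]linearN/= mulmxN -!opprD normrN.
- exact: (@cvgN R _ _ _ _ H (H y) (cH y Uy)).
Qed.

(** Covers both [phi], with its gradient, and [G], with its Jacobian: the increment is a model term
    tending to 0 plus a small remainder. *)
Lemma frechet_continuous (W : normedModType R) (F L : V -> W) x :
  (forall e : R, 0 < e ->
    \forall y \near x, `|F y - F x - L (y - x)| <= e * `|y - x|) ->
  L (y - x) @[y --> x] --> 0 -> F @ x --> F x.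
Proof.
move=> FL L0; apply/(@cvgrPdist_le R W V (nbhs x) (nbhs_filter x) F (F x)) => e e0.
have e20 : 0 < e / 2 by rewrite divr_gt0.
near=> y.
rewrite distrC -[F y - F x](subrK (L (y - x))) (le_trans (ler_normD _ _))//.
rewrite [e]splitr lerD//.
  have yx : `|y - x| <= e / 2.
    rewrite distrC; near: y.
    by have /cvgrPdist_le := @cvg_id _ (nbhs x); apply.
  (* The remainder estimate is taken with constant 1: it is then at most [|y - x|], hence at most
     [e / 2]. *)
  rewrite (le_trans _ yx)// -[leRHS]mul1r.
  by near: y; exact: FL.
rewrite -normrN -sub0r.
by near: y; move/cvgrPdist_le: L0; apply.
Unshelve. all: by end_near. Qed.

Lemma cvg_rV (T : Type) (F : set_system T) (FF : Filter F) (us : T -> V) (u : V) :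
  (forall j, us k 0 j @[k --> F] --> u 0 j) -> us @ F --> u.
Proof.
move=> usu; apply/cvgrPdist_le => e e0.
have : \forall k \near F, forall j, `|u 0 j - us k 0 j| <= e.
  by apply: filter_forall => j; move/cvgrPdist_le: (usu j); apply.
apply: filterS => k uk.
rewrite /Num.norm/= mx_normrE; apply: bigmax_le; first exact: ltW.
by move=> [i j] _; rewrite !mxE/= ord1.
Qed.

Lemma cvg_subr0 x : (y - x) @[y --> x] --> (0 : V).
Proof.
rewrite -[X in _ --> X](subrr x).
apply: (@cvgB R V V (nbhs x) _ id (fun=> x) x x); first exact: cvg_id.
exact: cvg_cst.
Qed.

Lemma C2_on_continuous U phi G H x : C2_on U phi G H -> U x ->
  phi @ x --> phi x.
Proof.
move=> [_ gradG _ _] Ux; apply: (@frechet_continuous _ _ (inner (G x))).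
  exact: gradG.
rewrite -(inner0r (G x)).
by apply: (@cvg_inner R n V (nbhs x) _ (fun=> G x) (fun y => y - x));
  [exact: cvg_cst|exact: cvg_subr0].
Qed.

Lemma C2_on_grad_continuous U phi G H x : C2_on U phi G H -> U x ->
  G @ x --> G x.
Proof.
move=> [_ _ jacH _] Ux; apply: (@frechet_continuous _ _ (fun d => d *m (H x)^T)).
  exact: jacH.
apply: (@cvg_rV V (nbhs x) _ (fun y => (y - x) *m (H x)^T) 0) => j.
have inn (d : V) : (d *m (H x)^T) 0 j = inner d (row j (H x)).
  by rewrite mxE; apply: eq_bigr => i _; rewrite !mxE.
rewrite mxE -(inner0l (row j (H x))).
rewrite (eq_fun (fun y => inn (y - x))).
by apply: (@cvg_inner R n V (nbhs x) _ (fun y => y - x) (fun=> row j (H x)));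
  [exact: cvg_subr0|exact: cvg_cst].
Qed.

Lemma dquotD U phi G h1 h2 x v (t : R) w : perturbed U phi h1 h2 ->
  U x -> U (x + t *: w) -> h1 x \is a fin_num -> 0 < t ->
  dquot h2 x (G x + v) t w =
    (dquot h1 x v t w + (rquot phi x (G x) t w)%:E)%E.
Proof.
move=> h12 Ux Uxt /fineK h1x t0; rewrite /dquot !h12// -h1x innerDl.
have k0 : 0 < 2 / t ^+ 2 by rewrite divr_gt0// exprn_gt0.
(* If [h1] is infinite there, both sides are the same infinity, since the factor [2 / t ^+ 2] is
   positive. *)
case: (h1 (x + t *: w)) => [r||] /=.
- by rewrite -!(EFinD, EFinN, EFinM) /rquot; congr EFin; ring.
- by rewrite ![(_ * (2 / _)%:E)%E]gt0_mulye ?lte_fin.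
- by rewrite ![(_ * (2 / _)%:E)%E]gt0_mulNye ?lte_fin.
Qed.

(** Each radius [d] in the supremum for [h2] is compared with [Num.min d d0] for [h1]: shrinking the
    range only raises the infimum, and within [d0] the added quotient is within [e] of the quadratic
    form. *)
Lemma d2_leD U phi G H h1 h2 x v w : C2_on U phi G H -> perturbed U phi h1 h2 ->
  U x -> h1 x \is a fin_num ->
  (d2 h2 x (G x + v) w <= d2 h1 x v w + (qform (H x) w)%:E)%E.
Proof.
move=> C2 h12 Ux h1x; apply/lee_addgt0Pr => e e0.
have [d0 d00 d0P] := rquot_near w C2 Ux e0.
apply: ge_ereal_sup => _ [d /= dgt0 <-].
rewrite -addeA -EFinD -leeBlDr//.
pose S := [set dquot h1 x v t w' | t in [set t : R | 0 < t < Num.min d d0]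
                                 & w' in [set w' | `|w' - w| < Num.min d d0]].
apply: (@le_trans _ _ (ereal_inf S)); last first.
  by apply: ereal_sup_ubound; exists (Num.min d d0) => //=; rewrite lt_min dgt0.
apply: le_ereal_inf_tmp => _ [t /= /andP[t0 td] [w' /= wd <-]].
move: td wd; rewrite !lt_min => /andP[td td0] /andP[wd wd0].
rewrite EFinN leeBlDr//.
have [Ut rq] := d0P t w' (introT andP (conj t0 td0)) wd0.
apply: (@le_trans _ _ (dquot h2 x (G x + v) t w')).
  apply: ereal_inf_lbound; exists t => /=; first by rewrite t0.
  by exists w'.
rewrite (dquotD G v h12)//; apply: leeD2l; rewrite lee_fin.
by rewrite -lerBlDl (le_trans (ler_norm _)).
Qed.

Lemma d2D U phi G H h1 h2 x v : C2_on U phi G H -> perturbed U phi h1 h2 ->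
  U x -> h1 x \is a fin_num ->
  d2 h2 x (G x + v) = (fun w => d2 h1 x v w + (qform (H x) w)%:E)%E.
Proof.
move=> C2 h12 Ux h1x; apply/funext => w; apply/eqP; rewrite eq_le (d2_leD _ _ C2 h12)//=.
have h2x : h2 x \is a fin_num by rewrite h12// fin_numD h1x.
(* The reverse inequality is the same lemma with the two functions exchanged and [phi] negated. *)
have := d2_leD (G x + v) w (C2_onN C2) (perturbedN h12) Ux h2x.
by rewrite addKr qformN EFinN leeBrDr.
Qed.

(** The added terms tend to [c w] along every sequence converging to [w], so the lower bound shifts
    by [c w] and a recovery sequence for [phis] serves for [psis] as well. The term [r] is asked for
    only eventually and along such sequences, since the perturbation formula holds only inside
    [U]. *)
Lemma epi_convD (phis psis : nat -> V -> \bar R) (q : V -> \bar R) (c : V -> R) :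
  (forall w (ws : nat -> V), ws @ \oo --> w -> forall e : R, 0 < e ->
    \forall k \near \oo, exists2 r : R,
      psis k (ws k) = (phis k (ws k) + r%:E)%E & `|r - c w| <= e) ->
  epi_conv phis q -> epi_conv psis (fun w => q w + (c w)%:E)%E.
Proof.
move=> phic epi w; have [liminf [ws [wsw limsup]]] := epi w; split.
  move=> us usw; apply: (le_trans (leeD2r _ (liminf us usw))).
  apply: limn_einf_leD => e e0; apply: filterS (phic w us usw e e0) => k.
  move=> [r -> rc]; apply: leeD2l; rewrite lee_fin lerBlDr -lerBlDl.
  by rewrite (le_trans (ler_norm _))// distrC.
exists ws; split => //; apply: (le_trans _ (leeD2r _ limsup)).
apply: limn_esup_leD => e e0; apply: filterS (phic w ws wsw e e0) => k.
move=> [r -> rc]; apply: leeD2l; rewrite lee_fin -lerBlDl.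
by rewrite (le_trans (ler_norm _)).
Qed.

Lemma twice_epi_diffD U phi G H h1 h2 x v : C2_on U phi G H ->
  perturbed U phi h1 h2 -> U x -> h1 x \is a fin_num ->
  twice_epi_diff h1 x v -> twice_epi_diff h2 x (G x + v).
Proof.
move=> C2 h12 Ux h1x epi ts ts0 ts_0.
rewrite (d2D v C2 h12)//.
apply: epi_convD (epi ts ts0 ts_0) => w ws wsw e e0.
have [d d0 dP] := rquot_near w C2 Ux e0.
near=> k.
have tk : 0 < ts k < d.
  rewrite ts0/= -[ts k]gtr0_norm// -normrN -sub0r; near: k.
  by move/cvgrPdist_lt: ts_0; apply.
have wk : `|ws k - w| < d.
  by rewrite distrC; near: k; move/cvgrPdist_lt: wsw; apply.
have [Uk rk] := dP _ _ tk wk.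
by exists (rquot phi x (G x) (ts k) (ws k)) => //; apply: dquotD h12 _ _ _ _.
Unshelve. all: by end_near. Qed.

(* [B] need not be symmetric: its symmetric part gives the same form. *)
Lemma gen_quad_formD (q : V -> \bar R) (B : 'M[R]_n) : gen_quad_form q ->
  gen_quad_form (fun w => q w + (qform B w)%:E)%E.
Proof.
move=> [A [L [symA ->]]]; exists (A + (B + B^T)), L; split.
  by rewrite !linearD/= trmxK symA [_^T + B]addrC.
apply/funext => w; case: ifP => // _; rewrite -EFinD; congr EFin.
by rewrite !qformD qform_tr; field.
Qed.

Lemma reg_subgradD U phi G H h1 h2 x v : C2_on U phi G H ->
  perturbed U phi h1 h2 -> U x -> reg_subgrad h1 x v ->
  reg_subgrad h2 x (G x + v).
Proof.
move=> [oU gradG _ _] h12 Ux [h1x regv].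
split; first by rewrite h12// fin_numD h1x.
(* One half of [e] goes to the gradient of [phi], the other to the subgradient of [h1]. *)
move=> e e0; have e20 : 0 < e / 2 by rewrite divr_gt0.
have Uy : \forall y \near x, U y by exact: open_nbhs_nbhs.
apply: filterS3 Uy (gradG x Ux _ e20) (regv _ e20) => y {}Uy grad.
rewrite !h12// -(fineK h1x) innerDl.
case: (h1 y) => [r||] //= reg; last by rewrite addye // leey.
move: reg grad; rewrite -!EFinD !lee_fin ler_norml => reg /andP[grad _].
by move: reg grad; set p := e / 2 * _; have -> : e * `|y - x| = p + p;
  [rewrite /p; field|lra].
Qed.

Lemma cvg_maxn (N : nat) : maxn k N @[k --> \oo] --> \oo.
Proof.
move=> P [M _ MP]; exists M => // k /= Mk.
by apply: MP; rewrite /= leq_max Mk.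
Qed.

(* Clamping the index, rather than shifting it, keeps the tail of the sequence
   in place. *)
Lemma cvg_mem_clamp (U : set V) (xs : nat -> V) x : open U -> U x ->
  xs @ \oo --> x -> exists N, forall k, U (xs (maxn k N)).
Proof.
move=> oU Ux xsx; have [N _ NP] : \forall k \near \oo, U (xs k).
  by apply: xsx; exact: open_nbhs_nbhs.
by exists N => k; apply: NP => /=; exact: leq_maxr.
Qed.

Lemma cvg_perturbed U phi G H h1 h2 (xs : nat -> V) x : C2_on U phi G H ->
  perturbed U phi h1 h2 -> U x -> (forall k, U (xs k)) -> xs @ \oo --> x ->
  h1 (xs k) @[k --> \oo] --> h1 x -> h2 (xs k) @[k --> \oo] --> h2 x.
Proof.
move=> C2 h12 Ux Uxs xsx h1xs; rewrite h12//.
under eq_fun do rewrite h12//.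
apply: cvgeD => //; first exact: fin_num_adde_defl.
apply: cvg_EFin; first exact: nearW.
exact: cvg_comp _ _ xsx (C2_on_continuous C2 Ux).
Qed.

Lemma lim_subgradD U phi G H h1 h2 x v : C2_on U phi G H ->
  perturbed U phi h1 h2 -> U x -> lim_subgrad h1 x v ->
  lim_subgrad h2 x (G x + v).
Proof.
move=> C2 h12 Ux [h1x [xs [vs [xsx hxs vsv reg]]]].
split; first by rewrite h12// fin_numD h1x.
(* Regular subgradients are required at every index, so the whole sequence has to lie in [U]. *)
have [N UN] := cvg_mem_clamp (let: And4 oU _ _ _ := C2 in oU) Ux xsx.
have xsNx : xs (maxn k N) @[k --> \oo] --> x
  by exact: cvg_comp _ _ (cvg_maxn N) xsx.
exists (fun k => xs (maxn k N)), (fun k => G (xs (maxn k N)) + vs (maxn k N)).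
split=> //.
- apply: (cvg_perturbed C2 h12) => //.
  exact: (cvg_comp _ (h1 \o xs) (cvg_maxn N)).
- apply: cvgD; last exact: cvg_comp _ _ (cvg_maxn N) vsv.
  exact: cvg_comp _ _ xsNx (C2_on_grad_continuous C2 Ux).
- by move=> k; exact: reg_subgradD C2 h12 _ _.
Qed.

Lemma OmegaD U phi G H h1 h2 x v : C2_on U phi G H ->
  perturbed U phi h1 h2 -> U x -> Omega h1 x v -> Omega h2 x (G x + v).
Proof.
move=> C2 h12 Ux [sub [epi gq]]; have h1x := sub.1.
split; first exact: lim_subgradD C2 h12 _ _.
split; first exact: twice_epi_diffD C2 h12 _ _ _.
by rewrite (d2D v C2 h12)//; exact: gen_quad_formD.
Qed.

(** Along an approximating sequence the halved second subderivatives gain the half-forms of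
    [H (xs k)]. These converge continuously to that of [H x] because [H] is continuous at [x], so
    [epi_convD] applies. *)
Lemma quad_bundleD U phi G H h1 h2 x v q : C2_on U phi G H ->
  perturbed U phi h1 h2 -> U x -> quad_bundle h1 x v q ->
  quad_bundle h2 x (G x + v) (fun w => q w + (qform (H x) w / 2)%:E)%E.
Proof.
move=> C2 h12 Ux [gq [xs [vs [Om xsx vsv hxs epi]]]]; split.
  have := gen_quad_formD (2^-1 *: H x) gq; congr gen_quad_form.
  by apply/funext => w; rewrite qformZl mulrC.
have [N UN] := cvg_mem_clamp (let: And4 oU _ _ _ := C2 in oU) Ux xsx.
have xsNx : xs (maxn k N) @[k --> \oo] --> x
  by exact: cvg_comp _ _ (cvg_maxn N) xsx.
exists (fun k => xs (maxn k N)), (fun k => G (xs (maxn k N)) + vs (maxn k N)).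
split.
- by move=> k; exact: OmegaD C2 h12 _ _.
- exact: xsNx.
- apply: cvgD; last exact: cvg_comp _ _ (cvg_maxn N) vsv.
  exact: cvg_comp _ _ xsNx (C2_on_grad_continuous C2 Ux).
- apply: (cvg_perturbed C2 h12) => //.
  exact: (cvg_comp _ (h1 \o xs) (cvg_maxn N)).
apply: epi_convD epi => w ws wsw e e0.
have cq : qform (H (xs (maxn k N))) (ws k) / 2 @[k --> \oo] --> qform (H x) w / 2.
  apply: cvgM; last exact: cvg_cst.
  apply: cvg_qform => //; apply: (cvg_comp _ _ xsNx).
  by case: C2 => _ _ _; apply.
move/cvgrPdist_le: cq => /(_ e e0).
(* From index [N] on the clamped index is [k] itself, so the original epi-convergent sequence is
   recovered. *)
apply: filterS2 (nbhs_infty_ge N) => k /maxn_idPl kN.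
rewrite kN => qk; have Uk : U (xs k) by rewrite -kN.
exists (qform (H (xs k)) (ws k) / 2); last by rewrite distrC.
have h1k := (Om k).1.1.
rewrite (d2D _ C2 h12)//.
rewrite muleDr//; last exact: fin_num_adde_defl.
by rewrite -EFinM mulrC.
Qed.

End Perturbation.

(** * The quadratic bundle of the zero function *)

Section ZeroFunction.
Context {R : realType} {n : nat}.
Notation V := 'rV[R]_n.
Notation zero := (fun _ : V => 0%E : \bar R).
Implicit Types x v w : V.

(** Testing the subgradient inequality at [x + s *: v] with small [s > 0] and dividing by [s] bounds
    [inner v v] by an arbitrarily small multiple of [|v|]. *)
Lemma reg_subgrad_zeroP x v : reg_subgrad zero x v <-> v = 0.
Proof.
split=> [[_ reg]|->]; last first.
  split=> // e e0; near=> y.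
  by rewrite inner0l sub0r add0e lee_fin oppr_le0 mulr_ge0// ltW.
apply: inner_self_eq0; apply/ler_addgt0Pr => e e0; rewrite add0r.
have v1 : 0 < `|v| + 1 by rewrite ltr_pwDr.
have [d d0 dP] := near_norm_ball (reg _ (divr_gt0 e0 v1)).
(* This makes [|s *: v| < d], so the test point lies in the ball where the inequality holds. *)
pose s := d / (2 * (`|v| + 1)).
have s0 : 0 < s by rewrite divr_gt0// mulr_gt0.
have sv : x + s *: v - x = s *: v by rewrite addrC addKr.
have /dP : `|x + s *: v - x| < d.
  rewrite sv normrZ gtr0_norm// /s mulrAC ltr_pdivrMr ?mulr_gt0// ltr_pM2l//.
  by rewrite mulr_natl mulrS (lt_le_trans (_ : _ < `|v| + 1)) ?ltrDl// lerDl ltW.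
rewrite sv add0e lee_fin innerZr normrZ gtr0_norm// subr_le0 mulrCA ler_pM2l//.
move=> /le_trans; apply; rewrite mulrAC ler_pdivrMr// ler_pM2l//.
by rewrite lerDl.
Unshelve. all: by end_near. Qed.

Lemma lim_subgrad_zeroP x v : lim_subgrad zero x v <-> v = 0.
Proof.
split=> [[_ [xs [vs [_ _ vsv reg]]]]|->].
  have vs0 : vs = (fun=> 0) by apply/funext => k; exact/(reg_subgrad_zeroP (xs k)).
  have /cvg_lim <- // := vsv; rewrite vs0.
  by apply: cvg_lim => //; exact: cvg_cst.
split=> //; exists (fun=> x), (fun=> 0); split; try exact: cvg_cst.
by move=> _; exact/reg_subgrad_zeroP.
Qed.

Lemma dquot_zero x (t : R) w : dquot zero x 0 t w = 0%E.
Proof. by rewrite /dquot inner0l mulr0 !sube0 mul0e. Qed.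

Lemma d2_zero x : d2 zero x 0 = zero.
Proof.
apply/funext => w; apply/eqP; rewrite eq_le; apply/andP; split.
  apply: ge_ereal_sup => _ [d /= d0 <-]; apply: ereal_inf_lbound.
  exists (d / 2) => /=; first by rewrite divr_gt0//= ltr_pdivrMr// ltr_pMr// ltr1n.
  by exists w; rewrite /= ?subrr ?normr0 ?dquot_zero.
apply: (@le_trans _ _ (ereal_inf [set dquot zero x 0 t w' | t in [set t : R | 0 < t < 1]
    & w' in [set w' | `|w' - w| < 1]])); last first.
  by apply: ereal_sup_ubound; exists 1 => //=.
by apply: le_ereal_inf_tmp => _ [t _ [w' _ <-]]; rewrite dquot_zero.
Qed.

(** The constant sequence at [w] gives [q w <= 0], and a recovery sequence gives [0 <= q w]. *)
Lemma epi_conv_zeroP (phis : nat -> V -> \bar R) (q : V -> \bar R) :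
  (forall k w, phis k w = 0%E) -> epi_conv phis q <-> q = zero.
Proof.
move=> phis0.
have lim0 (ws : nat -> V) : (fun k => phis k (ws k)) @ \oo --> (0%E : \bar R).
  by under eq_fun do rewrite phis0; exact: cvg_cst.
split=> [epi|->].
  apply/funext => w; have [liminf [ws [_ limsup]]] := epi w.
  apply/eqP; rewrite eq_le.
  have := liminf (fun=> w) (cvg_cst _).
  rewrite (cvg_limn_einf_sup (lim0 (fun=> w))) => -> /=.
  by move: limsup; rewrite (cvg_limn_einf_sup (lim0 ws)).
move=> w; split=> [ws _|]; first by rewrite (cvg_limn_einf_sup (lim0 ws)).
exists (fun=> w); split; first exact: cvg_cst.
by rewrite (cvg_limn_einf_sup (lim0 (fun=> w))).
Qed.

Lemma gen_quad_form_zero : gen_quad_form zero.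
Proof.
exists 0, 1%:M; split; first by rewrite linear0.
apply/funext => w; rewrite submx1 qformE linear0 mulmx0 inner0l.
by rewrite mul0r.
Qed.

(** Every subgradient is 0, so all second subderivatives along an approximating sequence vanish and
    the epi-limit must be zero; constant sequences attain it. *)
Lemma quad_bundle_zero x : quad_bundle zero x 0 = [set zero].
Proof.
apply/seteqP; split=> [q [_ [xs [vs [Om _ _ _ epi]]]]|_ ->] /=.
  apply: (iffLR (epi_conv_zeroP _ _)) epi => k w.
  have [/lim_subgrad_zeroP -> _] := Om k.
  by rewrite d2_zero mule0.
split; first exact: gen_quad_form_zero.
exists (fun=> x), (fun=> 0); split; try exact: cvg_cst.
  move=> _; split; first exact/lim_subgrad_zeroP.
  split; last by rewrite d2_zero; exact: gen_quad_form_zero.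
  move=> ts _ _; rewrite d2_zero; apply/epi_conv_zeroP => // k w.
  exact: dquot_zero.
by apply/epi_conv_zeroP => // k w; rewrite d2_zero mule0.
Qed.

End ZeroFunction.

Theorem theorem6p6 (R : realType) (n : nat) (f g : 'rV[R]_n -> \bar R)
    (xb : 'rV[R]_n) (G : 'rV[R]_n -> 'rV[R]_n) (H : 'rV[R]_n -> 'M[R]_n) :
  C2_around f xb G H -> proper_fun g -> lsc g ->
  forall vb : 'rV[R]_n, lim_subgrad g xb vb ->
    [/\ lim_subgrad (f \+ g)%E xb (G xb + vb),
        quad_bundle (f \+ g)%E xb (G xb + vb) =
          [set (fun w => ((qform (H xb) w / 2)%:E + p w)%E)
             | p in quad_bundle g xb vb],
        quad_bundle f xb (G xb) =
          [set (fun w => ((2^-1)%:E * d2 f xb (G xb) w)%E)] &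
        [set (fun w => ((2^-1)%:E * d2 f xb (G xb) w)%E)] =
          [set (fun w => (qform (H xb) w / 2)%:E)]].
Proof.
move=> [U [oU [Ux [finf gradG jacH cH]]]] _ _ vb subg.
pose phi y := fine (f y).
have C2 : C2_on U phi G H by [].
(* Kept generic because it serves twice: from [g] to [f \+ g], and from the zero function to [f]. *)
have quad_bundle_perturbed (h1 h2 : 'rV[R]_n -> \bar R) (v : 'rV[R]_n) :
    perturbed U phi h1 h2 -> quad_bundle h2 xb (G xb + v) =
    [set (fun w => ((qform (H xb) w / 2)%:E + p w)%E) | p in quad_bundle h1 xb v].
  move=> h12; apply/seteqP; split=> [q qh2|_ [p ph1 <-]]; last first.
    have := quad_bundleD C2 h12 Ux ph1.
    by congr (quad_bundle _ _ _ _); apply/funext => w; rewrite addeC.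
  (* Perturbing back by [- phi] returns the subgradient to [v] and exhibits [q] minus the half-form
     as the required [p]. *)
  have := quad_bundleD (C2_onN C2) (perturbedN h12) Ux qh2.
  rewrite addKr => ph1; eexists; first exact: ph1.
  by apply/funext => w /=; rewrite qformN mulNr EFinN addeC subeK.
have fg : perturbed U phi g (f \+ g)%E.
  by move=> y Uy; rewrite /= /phi fineK ?finf// addeC.
have f0 : perturbed U phi (fun=> 0%E) f.
  by move=> y Uy; rewrite add0e /phi fineK// finf.
have d2f : (fun w => ((2^-1)%:E * d2 f xb (G xb) w)%E) =
    (fun w => (qform (H xb) w / 2)%:E).
  apply/funext => w; rewrite -[G xb]addr0 (d2D 0 C2 f0)// d2_zero add0e.
  by rewrite -EFinM mulrC.
split.
- exact: lim_subgradD C2 fg Ux subg.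
- exact: quad_bundle_perturbed.
- rewrite d2f -[G xb]addr0 (quad_bundle_perturbed _ _ _ f0) quad_bundle_zero.
  by rewrite image_set1; congr [set _]; apply/funext => w; rewrite adde0.
- by rewrite d2f.
Qed.
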